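(* The set of $r\in Q_0$ for which $\lim_{n\to\infty}\frac{\tau(x^nr)}{n}=2$ has $\mu_0$-measure $1$.
   Context: $\mathbb{F}_2((x^{-1}))$ is the field of formal series $r=\sum_{z\in\mathbb{Z}}a_zx^z$, $a_z\in\mathbb{F}_2$, with $a_z\neq0$ for only finitely many positive $z$; $\deg(r)=\max\{z:a_z\ne0\}$; the polynomial part is $[r]=\sum_{z\ge0}a_zx^z$. Define $S(r)=\frac{r}{x+1}$ if $[r](1)=0$ and $S(r)=\frac{xr}{x+1}$ if $[r](1)=1$. For $r$ with $\deg(r)\ge0$, $\tau(r)$ is the least $k\in\mathbb{N}$ with $[S^k(r)]=1$ (finite). $Q_0=\{r:\deg(r)=0\}$, and $\mu_0$ is the probability measure on $Q_0$ under which the coefficients $a_{-1},a_{-2},\dots$ are independent and uniform in $\mathbb{F}_2$. *)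

(* Defs.v *)
From HB Require Import structures.
From mathcomp Require Import all_boot all_order all_algebra.
From mathcomp Require Import all_classical all_reals all_analysis.
Set Implicit Arguments. Unset Strict Implicit. Unset Printing Implicit Defensive.
Import Order.TTheory GRing.Theory Num.Theory.
Import numFieldNormedType.Exports.
Local Open Scope ring_scope.

(* An element r = sum_z a_z x^z of F_2((x^{-1})), given by its coefficient
   function (true = 1 in F_2) together with a natural number N such that
   a_z = 0 for all z > N (this encodes "a_z <> 0 for finitely many positive z"). *)
Record laurent := Laurent {
  coef : int -> bool ;
  lbound : nat ;
  coef_bounded : forall z : int, (lbound%:Z < z) -> coef z = false }.

Definition polypart_at1 (r : laurent) : bool :=
  \big[addb/false]_(i < (lbound r).+1) coef r (i%:Z).

(* [r] = 1 : a_0 = 1 and a_z = 0 for all z > 0 (for z > N this is automatic) *)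
Definition polypart_is1 (r : laurent) : bool :=
  coef r 0 && [forall i : 'I_(lbound r), ~~ coef r (i.+1)%:Z].

Lemma big_addb_false (n : nat) (F : nat -> bool) :
  (forall k, (k < n)%N -> F k = false) -> \big[addb/false]_(k < n) F k = false.
Proof. by move=> H; apply: big1 => k _; apply: H. Qed.

(* r / (x+1) = r * sum_{k>=1} x^{-k}:  c_z = sum_{k>=1} a_{z+k}
   (only the terms with z+k <= N can be nonzero; for z > N the sum below is
   over zero terms anyway) *)
Definition div_coef (r : laurent) (z : int) : bool :=
  \big[addb/false]_(k < `|(lbound r)%:Z - z|%N) coef r (z + (k.+1)%:Z).

Lemma div_coef_bounded (r : laurent) z : ((lbound r)%:Z < z) -> div_coef r z = false.
Proof.
move=> Hz; apply: big1 => k _; apply: (@coef_bounded r).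
by apply: (lt_le_trans Hz); rewrite lerDl.
Qed.

Definition div_xp1 (r : laurent) : laurent := Laurent (@div_coef_bounded r).

(* x r / (x+1) = r * sum_{k>=0} x^{-k}:  c_z = sum_{k>=0} a_{z+k} *)
Definition mdiv_coef (r : laurent) (z : int) : bool :=
  \big[addb/false]_(k < `|(lbound r)%:Z - z|%N.+1) coef r (z + k%:Z).

Lemma mdiv_coef_bounded (r : laurent) z : ((lbound r)%:Z < z) -> mdiv_coef r z = false.
Proof.
move=> Hz; apply: big1 => k _; apply: (@coef_bounded r).
by apply: (lt_le_trans Hz); rewrite lerDl.
Qed.

Definition mdiv_xp1 (r : laurent) : laurent := Laurent (@mdiv_coef_bounded r).

Definition S (r : laurent) : laurent :=
  if polypart_at1 r then mdiv_xp1 r else div_xp1 r.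

Definition xpow_coef (n : nat) (r : laurent) (z : int) : bool := coef r (z - n%:Z).

Lemma xpow_coef_bounded n r z : (((lbound r + n)%N)%:Z < z) -> xpow_coef n r z = false.
Proof.
move=> Hz; apply: (@coef_bounded r); rewrite ltrBrDr -PoszD; exact: Hz.
Qed.

Definition xpow (n : nat) (r : laurent) : laurent := Laurent (@xpow_coef_bounded n r).

(* tau(r) : least k with [S^k(r)] = 1  (set to 0 if no such k exists;
   the paper notes it always exists when deg r >= 0). *)
Definition tau (r : laurent) : nat :=
  match pselect (exists k, polypart_is1 (iter k S r)) with
  | left H => ex_minn H
  | right _ => 0%N
  end.

(* An element of Q_0 (deg r = 0, so a_0 = 1 and a_z = 0 for z > 0) is
   determined by its coefficients a_{-1}, a_{-2}, ...; we encode it by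
   w : nat -> bool with w i = a_{-(i+1)}. *)
Definition q0_coef (w : nat -> bool) (z : int) : bool :=
  if z == 0 then true else if z < 0 then w (`|z|%N.-1) else false.

Lemma q0_coef_bounded w z : (0%N%:Z < z) -> q0_coef w z = false.
Proof. by move=> Hz; rewrite /q0_coef gt_eqF // ltNge (ltW Hz). Qed.

Definition q0_of (w : nat -> bool) : laurent := Laurent (@q0_coef_bounded w).

Local Open Scope classical_set_scope.

Definition coord_events : set (set (nat -> bool)) :=
  [set A | exists (i : nat) (b : bool), A = [set w | w i = b]].

Definition seqspace := g_sigma_algebraType coord_events.

(* P makes the coordinates independent and uniform on F_2: every cylinder
   fixing the first n coordinates has probability 2^{-n}.  This characterizes
   mu_0 uniquely on the product sigma-algebra. *)
Definition is_mu0 (R : realType) (P : probability seqspace R) : Prop :=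
  forall (n : nat) (b : nat -> bool),
    P [set w : seqspace | forall i, (i < n)%N -> w i = b i] = ((2 ^- n : R)%:E).

Definition good_set (R : realType) : set seqspace :=
  [set w | (fun n : nat => ((tau (xpow n (q0_of w)))%:R / n%:R : R)) @ \oo --> (2 : R)].

(* Main.v *)
From Pilot Require Import Defs.
From HB Require Import structures.
From mathcomp Require Import all_boot all_order all_algebra.
From mathcomp Require Import all_classical all_reals all_analysis.
From mathcomp Require Import zify lra ring.
Import Pilot.Defs.
Set Implicit Arguments. Unset Strict Implicit. Unset Printing Implicit Defensive.
Import Order.TTheory GRing.Theory Num.Theory.
Import numFieldNormedType.Exports.

(** After k steps of S started at x^n r, with n - m of them dividing by x + 1
    only, one is at x^m r_k with r_k = r (x/(x+1))^k.  The next step lowers m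
    exactly when the partial sum of the coefficients of r_k up to x^{-m} is 0,
    and tau is the first time at which m = 0.

    From any (k, m) the parities of the next m steps determine the first m
    coefficients of r, so under mu_0 these parities are independent fair bits:
    outside an event of exponentially small probability, m steps bring the level
    from m to m/2 up to a factor 1 +- 1/p.  By Borel-Cantelli, almost surely this
    holds for all large m and all k <= 4m^3 at once.  Iterating from level n down
    to level n^{1/3} costs n + n/2 + n/4 + ... = 2n steps up to a relative error
    O(1/p), and from a level L the walk always ends within (L+1)^2 steps, which is
    o(n) for L = n^{1/3}. *)

(** * The descent of the level *)

Section Walk.
Variable w : nat -> bool.

(* The coefficient of x^{-m} in r (x/(x+1))^k, where r = q0_of w. *)
Fixpoint psum (k m : nat) : bool :=
  if k is k'.+1 then \big[addb/false]_(i < m.+1) psum k' i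
  else if m is m'.+1 then w m' else true.

Lemma psumS k m :
  psum k.+1 m = \big[addb/false]_(i < m.+1) psum k i.
Proof. by []. Qed.

Lemma psum_0 k : psum k 0 = true.
Proof. by elim: k => // k IHk; rewrite psumS big_ord1. Qed.

Lemma psum_pascal k m : psum k.+1 m.+1 = psum k.+1 m (+) psum k m.+1.
Proof. by rewrite !psumS big_ord_recr. Qed.

(* The level reached from (k, m) after j further steps. *)
Fixpoint level (k m j : nat) : nat :=
  if j is j'.+1 then
    let l := level k m j' in if psum (k + j').+1 l then l else l.-1
  else m.

Lemma levelS k m j :
  level k m j.+1 =
  if psum (k + j).+1 (level k m j) then level k m j else (level k m j).-1.
Proof. by []. Qed.

Lemma levelD k m i j : level k m (i + j) = level (k + i) (level k m i) j.
Proof. by elim: j => [|j IHj]; rewrite ?addn0 // addnS !levelS IHj addnA. Qed.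

Lemma level_homo k m i j : i <= j -> level k m j <= level k m i.
Proof.
move=> /subnK <-; elim: (j - i) => // d IHd; rewrite addSn levelS.
by case: ifP => // _; apply: leq_trans IHd; apply: leq_pred.
Qed.

Lemma level_le k m j : level k m j <= m.
Proof. exact: (@level_homo k m 0 j). Qed.

Lemma leq_levelD k m j : m <= level k m j + j.
Proof. by elim: j => [|j]; rewrite ?addn0 // levelS; case: ifP => _; lia. Qed.

(* If the walk stays at level m for m+1 steps then row k+1+i of the Pascal array
   vanishes at column m-i for 0 < i <= m, contradicting the value 1 in column 0. *)
Lemma level_ltn k m : 0 < m -> level k m m.+1 < m.
Proof.
move=> m0; rewrite ltnNge; apply/negP => lem.
have stay j : j <= m.+1 -> level k m j = m.
  by move=> /(level_homo k m); have := level_le k m j; lia.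
have one j : j <= m -> psum (k + j).+1 m.
  move=> jm; have := stay j.+1 jm; rewrite levelS (stay j) ?(leqW jm) //.
  by case: ifP => //; lia.
have diag i : i <= m -> forall j, j <= m - i -> psum (k + i + j).+1 (m - i) = (i == 0).
  elim: i => [|i IHi] im j jm; first by rewrite addn0 subn0 one //; lia.
  have := psum_pascal (k + i + j).+1 (m - i.+1).
  rewrite subnSK // IHi ?(ltnW im) //; last by lia.
  rewrite (_ : (k + i + j).+2 = (k + i + j.+1).+1); last by lia.
  rewrite IHi ?(ltnW im) //; last by lia.
  rewrite (_ : (k + i + j.+1).+1 = (k + i.+1 + j).+1); last by lia.
  by case: (i == 0) (psum _ _) => [] [].
by have := diag m (leqnn m) 0 (leq0n _); rewrite subnn psum_0; case: (m) m0.
Qed.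

Definition hits k m t := level k m t = 0 /\ forall j, j < t -> 0 < level k m j.

(** By [level_ltn] a level [m > 0] is left within [m + 1] steps, and
    [(m + 1) + m ^ 2 <= (m + 1) ^ 2] closes the strong induction. *)
Lemma hits_leq_square k m : exists2 t, hits k m t & t <= m.+1 ^ 2.
Proof.
have [t tm lt0] : exists2 t, t <= m.+1 ^ 2 & level k m t = 0.
  elim/ltn_ind: m k => m IHm k; case: (posnP m) => [->|m0]; first by exists 0.
  have lt := level_ltn k m0.
  have [t tle t0] := IHm _ lt (k + m.+1).
  exists (m.+1 + t); last by rewrite levelD.
  nia.
have ex : exists t, level k m t == 0 by exists t; apply/eqP.
exists (ex_minn ex); case: ex_minnP => u /eqP u0 umin; last first.
  by apply: leq_trans tm; apply: umin; apply/eqP.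
split=> // j ju; rewrite lt0n; apply/negP => /umin; lia.
Qed.

(** A step lowers the level by at most 1, so level 0 is not reached before time [i <= m]. *)
Lemma hitsD k m i t : i <= m -> hits (k + i) (level k m i) t -> hits k m (i + t).
Proof.
move=> im [t0 tmin]; split=> [|j jt]; first by rewrite levelD.
case: (ltnP j i) => ji; first by have := leq_levelD k m j; lia.
by rewrite -(subnKC ji) levelD; apply: tmin; lia.
Qed.

(* Each block of m steps halves the level up to m/p, so the times sum to
   m + m/2 + m/4 + ... = 2m; the budget k + 4m never increases. *)
Lemma hits_near_double p n L : 2 <= p ->
    (forall k m, k <= 4 * n -> L <= m ->
       p * (2 * level k m m) <= (p + 1) * m /\
       p * m <= p * (2 * level k m m) + m) ->
  forall m k, k + 4 * m <= 4 * n -> exists2 t, hits k m t &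
    p * t <= 2 * p * m + 4 * m + p * L.+1 ^ 2 /\
    2 * p * m <= p * t + 4 * m + p * L.+1 ^ 2.
Proof.
move=> p2 conc m k; elim/ltn_ind: m k => m IHm k km.
case: (ltnP m L) => mL.
  have [t ht tm] := hits_leq_square k m; exists t => //.
  have : m.+1 ^ 2 <= L.+1 ^ 2 by rewrite leq_exp2r // ltnS ltnW.
  have : 2 * m <= m.+1 ^ 2 by nia.
  by move: (m.+1 ^ 2) (L.+1 ^ 2) tm => a b tm ma ab; split; nia.
have [|up lo] := conc k m _ mL; first by lia.
case: (posnP m) => [m0|m0].
  exists 0; first by rewrite m0.
  by rewrite m0 !muln0; split.
set l := level k m m in up lo.
(* Since [p >= 2], the ratio [(p + 1) / (2 * p)] is at most 3/4. Hence [m + 4 * l <= 4 * m], which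
   preserves both the time budget and the error term [4 * m]. *)
have l34 : 4 * l <= 3 * m by nia.
have [||t ht [tup tlo]] := IHm l _ (k + m); try by lia.
exists (m + t); first exact: hitsD.
by move: (L.+1 ^ 2) tup tlo => b tup tlo; split; nia.
Qed.

End Walk.

(** * Propagation of zeros in a Pascal array over $\mathbb{F}_2$ *)

Section PascalDifference.
Variable D : nat -> nat -> bool.
Hypothesis D0 : forall k, D k 0 = false.
Hypothesis DS : forall k m, D k.+1 m.+1 = D k.+1 m (+) D k m.+1.

(** By induction the diagonal from [l 1] vanishes. If the first step descends, it continues the
    diagonal from [l 0]; if not, the recurrence moves its zeros one column to the left. *)
Lemma pascal_path_diag (l : nat -> nat) k j :
    (forall i, i < j -> l i.+1 = l i \/ l i.+1 = (l i).-1) ->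
    (forall i, i < j -> D (k + i).+1 (l i) = false) ->
  forall i, i < j -> D (k + i).+1 (l 0 - i) = false.
Proof.
elim: j k l => // j IHj k l lstep lzero.
have {}IHj i : i < j -> D (k.+1 + i).+1 (l 1 - i) = false.
  apply: (IHj k.+1 (l \o succn)) => {}i ij /=; first exact: lstep.
  by rewrite -(lzero i.+1 ij) addSnnS.
elim=> [|i IHi] ij; first by rewrite subn0; apply: lzero.
have {}IHj := IHj i ij; have {}IHi := IHi (ltnW ij).
case: (lstep 0) => // l1; last by rewrite -IHj l1 addSnnS; congr D; lia.
case: (leqP (l 0) i) => li.
  by rewrite (_ : l 0 - i.+1 = 0) //; lia.
have := DS (k + i).+1 (l 0 - i.+1); rewrite subnSK // IHi -l1.
by move: IHj; rewrite addSn l1 => ->; rewrite addnS addbF => <-.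
Qed.

(** Zeros pass from one antidiagonal (row plus column constant) to the preceding one: column 0
    starts, and the recurrence advances column by column. Row [k] meets all these antidiagonals. *)
Lemma pascal_diag_row k m :
    (forall i, i < m -> D (k + i).+1 (m - i) = false) ->
  forall l, l <= m -> D k l = false.
Proof.
move=> diag.
have tri d : d <= m -> forall l, l <= m - d -> D (k + (m - d) - l) l = false.
  elim: d => [|d IHd] dm.
    rewrite subn0; elim=> [|l IHl] lm //.
    have := DS (k + m - l.+1) l.
    rewrite (_ : (k + m - l.+1).+1 = k + m - l) ?IHl; try lia.
    have := diag (m - l.+1); rewrite (_ : m - (m - l.+1) = l.+1); last by lia.
    rewrite (_ : (k + (m - l.+1)).+1 = k + m - l) => [->|]; try lia.
  elim=> [|l IHl] lm //.
  have := DS (k + (m - d.+1) - l.+1) l.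
  rewrite (_ : (_ - l.+1).+1 = k + (m - d.+1) - l) ?IHl; try lia.
  have := IHd (ltnW dm) l.+1.
  rewrite (_ : k + (m - d) - l.+1 = k + (m - d.+1) - l) => [->|]; try lia.
by move=> l lm; have := tri (m - l) (leq_subr l m) l; rewrite subKn // addnK; apply.
Qed.

Lemma pascal_row_first k m :
  (forall l, l <= m -> D k l = false) -> forall l, l <= m -> D 0 l = false.
Proof.
elim: k => // k IHk rowk; apply: IHk; case=> [|l] lm //.
by have := DS k l; rewrite !rowk ?(ltnW lm).
Qed.

End PascalDifference.

Definition parity w k m i := psum w (k + i).+1 (level w k m i).

(** Equal parities force equal levels, so the difference of the two arrays vanishes along the common
    path, hence on a diagonal, in row [k], and finally in row 0, which holds the coefficients. *)
Lemma parity_inj w w' k m :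
    (forall i, i < m -> parity w k m i = parity w' k m i) ->
  forall i, i < m -> w i = w' i.
Proof.
move=> eqpar.
have eqlev i : i <= m -> level w k m i = level w' k m i.
  elim: i => // i IHi im; rewrite !levelS.
  by have := eqpar i im; rewrite /parity => ->; rewrite IHi // ltnW.
pose D k l := psum w k l (+) psum w' k l.
have D0 j : D j 0 = false by rewrite /D !psum_0.
have DS j l : D j.+1 l.+1 = D j.+1 l (+) D j l.+1.
  by rewrite /D !psum_pascal addbACA.
have diag i : i < m -> D (k + i).+1 (m - i) = false.
  apply: (pascal_path_diag D0 DS (l := level w k m)) => {}i im.
    by rewrite levelS; case: ifP; [left | right].
  have := eqpar i im; rewrite /parity /D -(eqlev i (ltnW im)) => ->.
  exact: addbb.
have rowk := pascal_diag_row D0 DS diag.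
move=> i im; have := pascal_row_first D0 DS rowk im.
by rewrite /D /=; case: (w i) (w' i) => [] [].
Qed.

Lemma eq_psum w w' k m :
  (forall i, i < m -> w i = w' i) -> forall l, l <= m -> psum w k l = psum w' k l.
Proof.
move=> eqw; elim: k => [|k IHk] [|l] lm //=; first exact: eqw.
all: by apply: eq_bigr => i _; apply: IHk; have := ltn_ord i; lia.
Qed.

Lemma eq_level w w' k m : (forall i, i < m -> w i = w' i) ->
  level w k m =1 level w' k m.
Proof.
move=> eqw; elim=> // j IHj; rewrite !levelS -IHj.
by rewrite (eq_psum _ eqw) ?level_le.
Qed.

(** A step descends exactly when its parity is 0. Before step [m] the level is positive, so the
    predecessor there is a true decrement. *)
Lemma level_parity w k m j : j <= m ->
  level w k m j + \sum_(i < j) ~~ parity w k m i = m.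
Proof.
elim: j => [|j IHj] jm; first by rewrite big_ord0 addn0.
have := IHj (ltnW jm); have := leq_levelD w k m j.
rewrite levelS -/(parity w k m j) big_ord_recr /=.
by case: (parity w k m j); lia.
Qed.

(** * The walk computes tau *)

(** [coef] is indexed by increasing exponent, [psum] downwards from the leading term; this turns
    sums of the former into prefix sums of the latter. *)
Lemma addb_sum_rev (f : nat -> bool) d N : (d < N)%N ->
  \big[addb/false]_(j < N) ((j <= d)%N && f (d - j)%N) =
  \big[addb/false]_(i < d.+1) f i.
Proof.
move=> dN; rewrite (eq_bigr (fun j : 'I_N => if (j <= d)%N then f (d - j)%N else false));
  last by move=> j _; case: leqP.
rewrite -big_mkcond /= -(big_ord_widen N (fun j => f (d - j)%N) dN).
rewrite (reindex_inj rev_ord_inj); apply: eq_bigr => i _ /=.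
by rewrite subSS subKn // -ltnS.
Qed.

Local Open Scope ring_scope.

(* r = x^m r_k; S never changes the field lbound, which keeps its initial value n. *)
Definition state n w k m (r : laurent) := lbound r = n /\
  forall z, coef r z = (z <= m%:Z) && psum w k `|m%:Z - z|%N.

Lemma state0 w n : state n w 0 n (xpow n (q0_of w)).
Proof.
split=> [|z] /=; first by rewrite add0n.
rewrite /xpow_coef /= /q0_coef subr_eq0 subr_lt0.
case: ltgtP => [zn|//|->]; last by rewrite subrr.
rewrite -[(`|n%:Z - z|)%N]distnC.
by case: (`|z - n|)%N (absz_gt0 (z - n%:Z)) => //; rewrite subr_eq0 lt_eqF.
Qed.

(** Multiplication by $x/(x+1)=1+x^{-1}+\cdots$ takes partial sums, so the value at 1 of the
    polynomial part is an entry of the next row. *)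
Lemma state_polypart_at1 n w k m r : (m <= n)%N -> state n w k m r ->
  polypart_at1 r = psum w k.+1 m.
Proof.
move=> mn [rn rE]; rewrite /polypart_at1 rn psumS.
rewrite -(addb_sum_rev _ (N := n.+1)) //; apply: eq_bigr => i _.
rewrite rE lez_nat; case: leqP => //= im.
by congr psum; lia.
Qed.

Lemma state_mdiv n w k m r : (m <= n)%N -> state n w k m r ->
  state n w k.+1 m (mdiv_xp1 r).
Proof.
move=> mn [rn rE]; split=> // z; rewrite /= /mdiv_coef rn.
case: leP => [zm|mz] /=; last first.
  by apply: big1 => i _; rewrite rE leNgt (lt_le_trans mz) // lerDl.
rewrite -(addb_sum_rev (psum w k) (N := `|n%:Z - z|%N.+1)); last by lia.
apply: eq_bigr => i _; rewrite rE.
rewrite (_ : (z + i%:Z <= m%:Z) = (i <= `|m%:Z - z|)%N); last by lia.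
by case: leqP => //= im; congr psum; lia.
Qed.

Lemma state_div n w k m r : (0 < m <= n)%N -> state n w k m r ->
  state n w k.+1 m.-1 (div_xp1 r).
Proof.
move=> /andP[m0 mn] [rn rE]; split=> // z; rewrite /= /div_coef rn.
case: leP => [zm|mz] /=; last first.
  by apply: big1 => i _; rewrite rE leNgt (_ : m%:Z < _) //; lia.
rewrite -(addb_sum_rev (psum w k) (N := `|n%:Z - z|%N)); last by lia.
apply: eq_bigr => i _; rewrite rE.
rewrite (_ : (z + i.+1%:Z <= m%:Z) = (i <= `|m.-1%:Z - z|)%N); last by lia.
by case: leqP => //= im; congr psum; lia.
Qed.

Lemma state_polypart_is1 n w k m r : (m <= n)%N -> state n w k m r ->
  polypart_is1 r = (m == 0%N).
Proof.
move=> mn [rn rE]; rewrite /polypart_is1 rn.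
apply/andP/eqP => [[_ /forallP coef0]|m0].
  case: m mn rE => // m mn rE; have := coef0 (Ordinal mn).
  by rewrite rE /= lexx subrr psum_0.
split; first by rewrite rE m0 subr0 psum_0.
by apply/forallP => i; rewrite rE m0.
Qed.

Lemma state_iter w n j :
  state n w j (level w 0 n j) (iter j S (xpow n (q0_of w))).
Proof.
elim: j => [|j IHj]; first exact: state0.
rewrite iterS levelS add0n /S (state_polypart_at1 (level_le _ _ _ _) IHj).
case: ifP => [_|one]; first by apply: state_mdiv => //; apply: level_le.
apply: state_div => //; rewrite level_le andbT lt0n.
(* At level 0 the parity is always 1, so division by $x+1$ occurs only at positive level. *)
by apply: contraFN one => /eqP ->; rewrite psum_0.
Qed.

Lemma tau_hits w n t : hits w 0 n t -> tau (xpow n (q0_of w)) = t.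
Proof.
have is1 j : polypart_is1 (iter j S (xpow n (q0_of w))) = (level w 0 n j == 0)%N.
  exact: state_polypart_is1 (level_le _ _ _ _) (state_iter w n j).
move=> [t0 tmin]; rewrite /tau; case: pselect => [ex|]; last first.
  by case; exists t; rewrite is1 t0.
case: ex_minnP => u; rewrite is1 => /eqP u0 umin.
apply/eqP; rewrite eqn_leq umin ?is1 ?t0 //= leqNgt; apply/negP => /tmin.
by rewrite u0.
Qed.

Lemma eq_tau w w' n : (forall i, (i < n)%N -> w i = w' i) ->
  tau (xpow n (q0_of w)) = tau (xpow n (q0_of w')).
Proof.
move=> eqw; have [t [t0 tmin] _] := hits_leq_square w 0 n.
rewrite (tau_hits (conj t0 tmin)); apply/esym/tau_hits.
by split=> [|j /tmin]; rewrite -(eq_level 0 eqw).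
Qed.

(** * Counting bit vectors with a large bias *)

Section Chernoff.
Variable R : realFieldType.
Implicit Types (t h c : R) (a b m p : nat).

Lemma sum_prod_bias t m :
  \sum_(v : {ffun 'I_m -> bool}) \prod_i (if v i then 1 + t else 1 - t) = 2 ^+ m.
Proof.
rewrite -(bigA_distr_bigA (fun (_ : 'I_m) (b : bool) => if b then 1 + t else 1 - t)).
rewrite (eq_bigr (fun _ => 2)) ?prodr_const ?card_ord // => i _.
by rewrite big_bool /=; ring.
Qed.

Lemma prod_bias (x y : R) m (v : 'I_m -> bool) :
  \prod_i (if v i then x else y) = x ^+ (\sum_i v i) * y ^+ (\sum_i ~~ v i).
Proof.
rewrite !expr_sum -big_split; apply: eq_bigr => i _.
by case: (v i); rewrite /= expr0 expr1 ?mulr1 ?mul1r.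
Qed.

Lemma bernoulli_ineq c n : 0 <= c <= 1 -> 1 - n%:R * c <= (1 - c) ^+ n.
Proof.
move=> /andP[c0 c1]; elim: n => [|n IHn]; first by rewrite mul0r subr0 expr0.
have n0 : 0 <= n%:R :> R by [].
rewrite exprS -natr1; have : (1 - c) * (1 - n%:R * c) <= (1 - c) * (1 - c) ^+ n.
  by apply: ler_wpM2l => //; lra.
nra.
Qed.

Lemma linear_geometric_le c n : 0 <= c <= 1 -> (1 + n%:R * c) * (1 - c) ^+ n <= 1.
Proof.
move=> /andP[c0 c1]; elim: n => [|n IHn]; first by rewrite mul0r expr0; lra.
have n0 : 0 <= n%:R :> R by [].
apply: le_trans IHn; rewrite exprS -natr1 mulrA ler_wpM2r ?exprn_ge0 //; nra.
Qed.

(** Compare [p]-th powers with the [m]-th power of the hypothesis: [p * b] factors [1 + t] pair with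
    the [1 - t] into powers of [1 - t ^+ 2], and at least [m] factors [1 + t] remain. *)
Lemma bias_ge1 h t p a b m : (0 < p)%N -> 0 <= h -> 0 <= t <= 1 ->
    1 <= h ^+ (4 * p) * (1 - t ^+ 2) ^+ p * (1 + t) ->
    m = (a + b)%N -> (m + p * b <= p * a)%N ->
  1 <= h ^+ (4 * m) * ((1 + t) ^+ a * (1 - t) ^+ b).
Proof.
move=> p0 h0 /andP[t0 t1] hyp mab mpa.
have W0 : 0 <= h ^+ (4 * m) * ((1 + t) ^+ a * (1 - t) ^+ b).
  by rewrite !mulr_ge0 // exprn_ge0 //; lra.
have t2 : 0 <= 1 - t ^+ 2 by rewrite subr_ge0 exprn_ile1.
rewrite -(expr_ge1 p0 W0).
have -> : (h ^+ (4 * m) * ((1 + t) ^+ a * (1 - t) ^+ b)) ^+ p =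
    (h ^+ (4 * p)) ^+ m * ((1 - t ^+ 2) ^+ (p * b) *
    ((1 + t) ^+ m * (1 + t) ^+ (p * a - (m + p * b)))).
  have -> : 1 - t ^+ 2 = (1 + t) * (1 - t) by ring.
  rewrite !exprMn -!exprM mulrACA.
  have -> : (4 * m * p = 4 * p * m)%N by lia.
  have -> : (a * p = p * b + (m + (p * a - (m + p * b))))%N by nia.
  by rewrite (mulnC b p) !exprD; ring.
have := exprn_ege1 m hyp; move/le_trans; apply.
rewrite !exprMn -!mulrA; apply: ler_wpM2l; first by rewrite !exprn_ge0.
apply: ler_pM; rewrite ?exprn_ge0 //; first by lra.
  rewrite -exprM; apply: ler_wiXn2l => //; last by nia.
  by rewrite lerBlDr lerDl exprn_ge0.
by rewrite ler_peMr ?exprn_ge0 ?exprn_ege1 //; lra.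
Qed.

(** Ones outnumber zeros by at least [m / p], written without subtraction. *)
Definition excess p m (v : {ffun 'I_m -> bool}) :=
  (m + p * (\sum_i ~~ v i) <= p * (\sum_i v i))%N.

Lemma sum_negb m (v : 'I_m -> bool) : (\sum_i v i + \sum_i ~~ v i = m)%N.
Proof.
rewrite -big_split /= (eq_bigr (fun=> 1%N)) ?sum1_card ?card_ord // => i _.
by case: (v i).
Qed.

(** Exponential Markov inequality: the product weights sum to [2 ^+ m], and by [bias_ge1] each
    counted vector weighs at least [h ^- (4 * m)]. *)
Lemma card_excess h t p m : (0 < p)%N -> 0 <= h -> 0 <= t <= 1 ->
    1 <= h ^+ (4 * p) * (1 - t ^+ 2) ^+ p * (1 + t) ->
  #|[set v : {ffun 'I_m -> bool} | excess p v]|%:R <= 2 ^+ m * h ^+ (4 * m).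
Proof.
move=> p0 h0 t01 hyp; rewrite -sum1_card natr_sum mulrC -(sum_prod_bias t) mulr_sumr.
rewrite [leRHS](bigID (fun v => excess p v)) /=.
rewrite -[leLHS]addr0; apply: lerD; last first.
  apply: sumr_ge0 => v _; rewrite mulr_ge0 ?exprn_ge0 // prodr_ge0 // => i _.
  by case: ifP => _; lra.
under eq_bigl do rewrite inE.
apply: ler_sum => v ev; rewrite prod_bias.
by apply: (bias_ge1 p0 h0 t01 hyp) => //; rewrite sum_negb.
Qed.

Lemma card_excess_negb p m :
  #|[set v : {ffun 'I_m -> bool} | excess p [ffun i => ~~ v i]]| =
  #|[set v : {ffun 'I_m -> bool} | excess p v]|.
Proof.
pose f (v : {ffun 'I_m -> bool}) := [ffun i => ~~ v i].
have fK : involutive f by move=> v; apply/ffunP => i; rewrite !ffunE negbK.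
rewrite -[RHS](card_preimset _ (inv_inj fK)).
by apply: eq_card => v; rewrite !inE.
Qed.

(** Chosen so that [4 * p] of these steps add up to [1 / (8 * p + 1)]. *)
Definition decay_step p : R := (4 * p * (8 * p).+1)%:R^-1.
Definition decay p : R := 1 - decay_step p.

Lemma decay_step_itv p : (0 < p)%N -> 0 < decay_step p < 1.
Proof.
move=> p0; rewrite invr_gt0 invf_lt1 ?ltr0n ?ltr1n; nia.
Qed.

(* Bernoulli's inequality with t = 1/(2p): the left factor is at least 8p/(8p+1)
   and the product of the other two at least (1 - 1/(4p))(1 + 1/(2p)) >= (8p+1)/(8p). *)
Lemma decay_bias p (t := (2 * p)%:R^-1) : (0 < p)%N ->
  1 <= decay p ^+ (4 * p) * (1 - t ^+ 2) ^+ p * (1 + t).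
Proof.
move=> p0; have /andP[c0 c1] := decay_step_itv p0.
have pR : 1 <= p%:R :> R by rewrite ler1n.
have tE : t = 2^-1 / p%:R by rewrite /t natrM invfM.
have x0 : 0 < p%:R^-1 :> R by rewrite invr_gt0; lra.
have x1 : p%:R^-1 <= 1 :> R by rewrite invf_le1; lra.
have tpos : 0 <= t <= 1 by rewrite tE; nra.
have A : (8 * p)%:R / (8 * p).+1%:R <= decay p ^+ (4 * p).
  apply: le_trans (bernoulli_ineq _ _); last by rewrite !ltW.
  suff -> : 1 - (4 * p)%:R * decay_step p = (8 * p)%:R / (8 * p).+1%:R by [].
  by rewrite /decay_step !(natrM, =^~ natr1); field; apply/andP; split; lra.
have B : 1 - p%:R * t ^+ 2 <= (1 - t ^+ 2) ^+ p.
  by apply: bernoulli_ineq; nra.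
have C : (8 * p).+1%:R / (8 * p)%:R <= (1 - t ^+ 2) ^+ p * (1 + t).
  apply: (@le_trans _ _ ((1 - p%:R * t ^+ 2) * (1 + t))); last first.
    by apply: ler_wpM2r => //; lra.
  rewrite tE -natr1 natrM.
  have -> : (8 * p%:R + 1) / (8 * p%:R) = 1 + p%:R^-1 / 8 :> R by field; lra.
  have -> : p%:R * (2^-1 / p%:R) ^+ 2 = p%:R^-1 / 4 :> R by field; lra.
  nra.
rewrite -mulrA; apply: le_trans (ler_pM _ _ A C); rewrite ?divr_ge0 ?ler0n //.
by rewrite mulrA divfK ?divff ?pnatr_eq0 //; lia.
Qed.

Lemma card_deviation p m : (0 < p)%N ->
  #|[set v : {ffun 'I_m -> bool} | excess p v || excess p [ffun i => ~~ v i]]|%:R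
    <= 2 ^+ m * (2 * decay p ^+ (4 * m)).
Proof.
move=> p0; have /andP[c0 c1] := decay_step_itv p0.
have h0 : 0 <= decay p by rewrite /decay; lra.
have t01 : 0 <= ((2 * p)%:R^-1 : R) <= 1.
  by rewrite invr_ge0 ler0n invf_le1 ?ltr0n ?ler1n; lia.
have E := card_excess m p0 h0 t01 (decay_bias p0).
apply: (@le_trans _ _ (#|[set v : {ffun 'I_m -> bool} | excess p v]| +
  #|[set v : {ffun 'I_m -> bool} | excess p [ffun i => ~~ v i]]|)%:R).
  rewrite ler_nat; apply: leq_trans (leq_card_setU _ _); apply: subset_leq_card.
  by apply/fintype.subsetP => v; rewrite !inE.
by rewrite natrD card_excess_negb; lra.
Qed.

End Chernoff.

(** * Almost sure behaviour of the walk *)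

Local Open Scope classical_set_scope.

Definition extend n (v : {ffun 'I_n -> bool}) (i : nat) : bool :=
  if insub i is Some j then v j else false.

Lemma extendE n (v : {ffun 'I_n -> bool}) (j : 'I_n) : extend v j = v j.
Proof. by rewrite /extend valK. Qed.

Lemma extend_restrict n (w : nat -> bool) i :
  (i < n)%N -> extend [ffun j : 'I_n => w j] i = w i.
Proof. by move=> lt_in; rewrite (extendE _ (Ordinal lt_in)) ffunE. Qed.

Definition cylinder n (b : nat -> bool) : set seqspace :=
  [set w : seqspace | forall i, (i < n)%N -> w i = b i].

Lemma measurable_cylinder n b : measurable (cylinder n b).
Proof.
have -> : cylinder n b = \bigcap_(i in [set i | (i < n)%N]) [set w : seqspace | w i = b i].
  by apply/seteqP; split.
apply: bigcap_measurableType => i _; apply: sub_sigma_algebra.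
by exists i, (b i).
Qed.

Definition finevent n (B : {set {ffun 'I_n -> bool}}) : set seqspace :=
  [set w : seqspace | [ffun i : 'I_n => w i] \in B].

Lemma fineventE n B :
  @finevent n B = \big[setU/set0]_(v in B) cylinder n (extend v).
Proof.
rewrite -bigcup_seq_cond; apply/seteqP; split=> w /=.
  move=> wB; exists [ffun i : 'I_n => w i] => [|i im] /=.
    by rewrite mem_index_enum.
  by rewrite extend_restrict.
move=> [v /= /andP[_ vB] wv]; rewrite /finevent /=.
suff -> : [ffun i : 'I_n => w i] = v by [].
by apply/ffunP => i; rewrite ffunE wv // extendE.
Qed.

Lemma measurable_finevent n B : measurable (@finevent n B).
Proof.
by rewrite fineventE; apply: bigsetU_measurable => v _; exact: measurable_cylinder.
Qed.

(** Reduces such an event to finitely many cylinders, for measurability and for counting. *)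
Lemma finite_dependence n (D : set seqspace) :
    (forall w w' : seqspace, (forall i, (i < n)%N -> w i = w' i) -> D w -> D w') ->
  D = finevent [set v : {ffun 'I_n -> bool} | `[< D (extend v) >]]%SET.
Proof.
move=> dep; apply/seteqP; split=> w; rewrite /finevent /= inE.
  by move=> Dw; apply/asboolP; apply: dep Dw => i im; rewrite extend_restrict.
by move/asboolP; apply: dep => i im; rewrite extend_restrict.
Qed.

Lemma measure_bigsetU_le (R : realType) (d : measure_display) (T : measurableType d)
    (P : {measure set T -> \bar R}) (I : Type) (s : seq I) (Q : pred I) (F : I -> set T) :
    (forall i, Q i -> measurable (F i)) ->
  (P (\big[setU/set0]_(i <- s | Q i) F i) <= \sum_(i <- s | Q i) P (F i))%E.
Proof.
move=> mF; suff [] : measurable (\big[setU/set0]_(i <- s | Q i) F i) /\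
  (P (\big[setU/set0]_(i <- s | Q i) F i) <= \sum_(i <- s | Q i) P (F i))%E by [].
apply: (big_ind2 (fun A x => measurable A /\ (P A <= x)%E)) => //.
- by rewrite measure0.
- move=> A x B y [mA Ax] [mB By]; split; first exact: measurableU.
  by apply: le_trans (leeD Ax By); apply: measureU2.
- by move=> i Qi; split=> //; exact: mF.
Qed.

(** * Probability of a deviation from halving *)

Section Mu0.
Variables (R : realType) (P : probability seqspace R).
Hypothesis mu0 : is_mu0 P.

Lemma mu0_finevent n (B : {set {ffun 'I_n -> bool}}) :
  (P (finevent B) <= (#|B|%:R / 2 ^+ n)%:E)%E.
Proof.
rewrite fineventE; apply: le_trans (measure_bigsetU_le _ _ _) _.
  by move=> v _; exact: measurable_cylinder.
rewrite (eq_bigr (fun=> (2 ^- n)%:E)) => [|v _]; last exact: mu0.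
by rewrite sumEFin sumr_const lee_fin mulr_natl.
Qed.

Definition deviates p k m (w : nat -> bool) :=
  ~ ((p * (2 * level w k m m) <= (p + 1) * m)%N /\
     (p * m <= p * (2 * level w k m m) + m)%N).

Lemma eq_deviates p k m (w w' : nat -> bool) :
  (forall i, (i < m)%N -> w i = w' i) -> deviates p k m w -> deviates p k m w'.
Proof. by move=> /(eq_level k) eqw; rewrite /deviates eqw. Qed.

Lemma measurable_deviates p k m :
  measurable ([set w : seqspace | deviates p k m w]).
Proof.
rewrite (@finite_dependence m [set w | deviates p k m w] (@eq_deviates p k m)).
exact: measurable_finevent.
Qed.

(** By [parity_inj] the map from the first [m] coefficients to the [m] parities is injective, so
    deviating prefixes are at most as many as biased bit vectors. *)
Lemma mu0_deviates p k m : (0 < p)%N ->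
  (P [set w : seqspace | deviates p k m w] <= (2 * decay R p ^+ (4 * m))%:E)%E.
Proof.
move=> p0; rewrite (@finite_dependence m [set w | deviates p k m w] (@eq_deviates p k m)).
apply: le_trans (mu0_finevent _) _; rewrite lee_fin ler_pdivrMr ?exprn_gt0 //.
rewrite mulrC; apply: le_trans (card_deviation R m p0); rewrite ler_nat.
pose f (v : {ffun 'I_m -> bool}) := [ffun i : 'I_m => parity (extend v) k m i].
have f_inj : injective f.
  move=> v v' /ffunP eqf; apply/ffunP => i; rewrite -!extendE.
  apply: (@parity_inj _ _ k m) => // j jm.
  by have := eqf (Ordinal jm); rewrite !ffunE.
rewrite -[leqLHS](card_imset _ f_inj); apply: subset_leq_card.
apply/fintype.subsetP => _ /imsetP[v + ->]; rewrite !inE => /asboolP/asboolP.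
rewrite /= /deviates => dev.
pose par i := parity (extend v) k m i.
have E1 : (\sum_i f v i = \sum_(i < m) par i)%N.
  by apply: eq_bigr => i _; rewrite ffunE.
have E2 : (\sum_i ~~ f v i = \sum_(i < m) ~~ par i)%N.
  by apply: eq_bigr => i _; rewrite ffunE.
have E3 : (\sum_i [ffun i => ~~ f v i] i = \sum_(i < m) ~~ par i)%N.
  by apply: eq_bigr => i _; rewrite !ffunE.
have E4 : (\sum_i ~~ [ffun i => ~~ f v i] i = \sum_(i < m) par i)%N.
  by apply: eq_bigr => i _; rewrite !ffunE negbK.
rewrite /excess E1 E2 E3 E4; apply/negPn/negP; rewrite negb_or -!ltnNge => /andP[up lo].
(* Together with [sum_negb] this identifies the final level with the number of parities equal to
   1. *)
apply: dev; have := level_parity (extend v) k (leqnn m).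
have := sum_negb (fun i : 'I_m => par i).
rewrite -/(par _); move: up lo.
move: (\sum_(i < m) par i)%N (\sum_(i < m) ~~ par i)%N => x y /=.
by split; nia.
Qed.

End Mu0.

Lemma tau_near_double w p M : (2 <= p)%N ->
    (forall m k, (M <= m)%N -> (k <= 4 * m ^ 3)%N -> ~ deviates p k m w) ->
  forall n, ((M + 9 * p + 2) ^ 3 <= n)%N ->
    (p * tau (xpow n (q0_of w)) <= 2 * p * n + 5 * n)%N /\
    (2 * p * n <= p * tau (xpow n (q0_of w)) + 5 * n)%N.
Proof.
move=> p2 conc n nbig.
have ex : exists L, (n <= L ^ 3)%N.
  by exists n; case: (posnP n) => [->|n0] //; rewrite -[leqLHS]expn1 leq_pexp2l.
case: (ex_minnP ex) => L nL Lmin.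
have Lbig : (M + 9 * p + 2 <= L)%N.
  by rewrite -(@leq_exp2r _ _ 3) //; apply: leq_trans nbig nL.
have Lpred : (L.-1 ^ 3 < n)%N.
  by rewrite ltnNge; apply/negP => /Lmin; lia.
have [||t ht] := @hits_near_double w p n L p2 _ n 0; last first.
- rewrite (tau_hits ht).
  (* [L >= 2] gives [L + 1 <= 3 * (L - 1)], and [9 * p <= L - 1] bounds the left side by
     [(L - 1) ^ 3 < n]. The error [4 * n] thus becomes [5 * n]. *)
  have : (p * L.+1 ^ 2 <= n)%N.
    apply: leq_trans (ltnW Lpred); rewrite (expnS _ 2).
    have L3 : (L.+1 <= 3 * L.-1)%N by lia.
    have : (L.+1 ^ 2 <= (3 * L.-1) ^ 2)%N by rewrite leq_exp2r.
    rewrite expnMn; have : (9 * p <= L.-1)%N by lia.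
    by move: (L.-1 ^ 2)%N (L.+1 ^ 2)%N => x y; nia.
  by move: (p * L.+1 ^ 2)%N => x; lia.
- by lia.
move=> k m kn Lm; apply: contrapT; apply: conc; first by lia.
apply: leq_trans kn _; rewrite leq_mul2l /=; apply: leq_trans nL _.
by rewrite leq_exp2r.
Qed.

(** The range of [k] covers the time budget [4 * n] of every walk from a level [n <= m ^ 3]. *)
Definition deviates_early p m : set seqspace :=
  \big[setU/set0]_(k < (4 * m ^ 3).+1) [set w : seqspace | deviates p k m w].

Lemma deviates_earlyP p m k w :
  (k <= 4 * m ^ 3)%N -> deviates p k m w -> deviates_early p m w.
Proof.
move=> km dev; rewrite /deviates_early.
by rewrite -(bigcup_mkord _ (fun k => [set w : seqspace | deviates p k m w])); exists k.
Qed.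

Lemma measurable_deviates_early p m : measurable (deviates_early p m).
Proof. by apply: bigsetU_measurable => k _; exact: measurable_deviates. Qed.

(** Of the four factors [(1 - c) ^+ n], three absorb the cube through [n%:R * (1 - c) ^+ n <= c^-1];
    the fourth stays as a summable geometric term. *)
Lemma cubic_geometric_le (R : realFieldType) (c : R) n : 0 < c < 1 ->
  (4 * n ^ 3).+1%:R * (2 * (1 - c) ^+ (4 * n)) <=
  2 * (4 * (c^-1) ^+ 3 + 1) * (1 - c) ^+ n.
Proof.
move=> /andP[c0 c1]; set h := 1 - c.
have h0 : 0 <= h by rewrite /h; lra.
have hn0 : 0 <= h ^+ n by rewrite exprn_ge0.
have hn1 : h ^+ n <= 1 by rewrite exprn_ile1 // /h; lra.
have lin : n%:R * h ^+ n <= c^-1.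
  have := @linear_geometric_le R c n; rewrite (ltW c0) (ltW c1) -/h => /(_ isT) lin.
  by rewrite -[leRHS]div1r ler_pdivlMr //; nra.
have cub : (n%:R * h ^+ n) ^+ 3 <= (c^-1) ^+ 3.
  by rewrite lerXn2r ?nnegrE ?mulr_ge0 ?invr_ge0 ?(ltW c0).
have -> : (4 * n ^ 3).+1%:R * (2 * h ^+ (4 * n)) =
    2 * (4 * (n%:R * h ^+ n) ^+ 3 + (h ^+ n) ^+ 3) * h ^+ n.
  by rewrite -natr1 natrM natrX mulnC exprM; ring.
rewrite ler_wpM2r // ler_wpM2l // lerD ?ler_wpM2l //.
by rewrite exprn_ile1.
Qed.

(** * Borel-Cantelli and the limit *)

Section Almost.
Variables (R : realType) (P : probability seqspace R).
Hypothesis mu0 : is_mu0 P.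

Lemma mu0_limsup_deviates_early p : (0 < p)%N ->
  P (lim_sup_set (deviates_early p)) = 0%E.
Proof.
move=> p0; have := decay_step_itv R p0; set c := decay_step R p => c01.
have /andP[c0 c1] := c01.
set K := 2 * (4 * (c^-1) ^+ 3 + 1).
have K0 : 0 <= K.
  by rewrite mulr_ge0 // addr_ge0 // mulr_ge0 // exprn_ge0 // invr_ge0 ltW.
have PF m : (P (deviates_early p m) <= (geometric K (1 - c) m)%:E)%E.
  apply: le_trans (measure_bigsetU_le _ _ _) _ => [k _|].
    exact: measurable_deviates.
  apply: (@le_trans _ _ (\sum_(k < (4 * m ^ 3).+1) (2 * decay R p ^+ (4 * m))%:E)%E).
    by apply: lee_sum => k _; exact: mu0_deviates.
  rewrite sumEFin sumr_const card_ord lee_fin -[leLHS]mulr_natl.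
  exact: cubic_geometric_le.
apply: lim_sup_set_cvg0 => [m|]; first exact: measurable_deviates_early.
apply: (@le_lt_trans _ _ (K * (1 - (1 - c))^-1)%:E); last exact: ltry.
apply: lime_le; first exact: is_cvg_ereal_nneg_natsum_cond.
apply: nearW => n.
apply: (@le_trans _ _ (\sum_(0 <= m < n) (geometric K (1 - c) m)%:E)%E).
  by apply: lee_sum => m _; exact: PF.
rewrite sumEFin lee_fin; apply: geometric_le_lim => //; first by lra.
by rewrite ger0_norm; lra.
Qed.

Lemma not_limsup_good w :
  (forall p, ~ lim_sup_set (deviates_early p.+2) w) -> good_set R w.
Proof.
move=> notsup; apply/cvgrPdist_le => e e0.
(* The relative error in [tau_near_double] is [5 / p], which must be at most [e]; the form [.+2]
   also ensures [p >= 2]. *)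
pose p := (Num.truncn (5 / e)).+2.
have pe : 5 / p%:R <= e.
  rewrite ler_pdivrMr ?ltr0n // -ler_pdivrMl // mulrC.
  have := truncnS_gt (5 / e); rewrite -/p => /ltW /le_trans; apply.
  by rewrite ler_nat.
have /existsNP[M /not_implyP[_ notM]] := notsup (Num.truncn (5 / e)).
have conc m k : (M <= m)%N -> (k <= 4 * m ^ 3)%N -> ~ deviates p k m w.
  by move=> Mm km dev; apply: notM; exists m => //; exact: deviates_earlyP dev.
exists ((M + 9 * p + 2) ^ 3)%N => // n /= nbig.
have [//|up lo] := tau_near_double _ conc nbig.
have n0 : (0 < n)%N by apply: leq_trans nbig; rewrite expn_gt0 addn_gt0 orbT.
apply: le_trans pe.
rewrite -(ler_nat R) natrD !natrM in up; rewrite -(ler_nat R) natrD !natrM in lo.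
have : 0 < n%:R :> R by rewrite ltr0n.
have : 0 < p%:R :> R by rewrite ltr0n.
move: (tau _)%:R (n%:R) (p%:R) up lo => t x y up lo y0 x0.
have -> : 2 - t / x = (2 * x - t) / x by field; lra.
rewrite normrM normfV (gtr0_norm x0) ler_pdivrMr // mulrAC ler_pdivlMr //.
by rewrite -{1}(gtr0_norm y0) -normrM ler_norml; apply/andP; split; nra.
Qed.

(** Convergence is tested on the countably many tolerances [1 / (j + 1)], and by [eq_tau] each
    condition depends on finitely many coordinates. *)
Lemma measurable_good_set : measurable (good_set R).
Proof.
pose close j n := [set w : seqspace |
  `|2 - (tau (xpow n (q0_of w)))%:R / n%:R| <= j.+1%:R^-1 :> R].
have mclose j n : measurable (close j n).
  rewrite (@finite_dependence n (close j n)); first exact: measurable_finevent.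
  by move=> w w' /eq_tau eqt; rewrite /close /= eqt.
have -> : good_set R =
    \bigcap_j \bigcup_N \bigcap_(n in [set n | (N <= n)%N]) close j n.
  apply/seteqP; split=> [w /cvgrPdist_le cvgw j _|w closew].
    have [|N _ HN] := cvgw j.+1%:R^-1; first by rewrite invr_gt0.
    by exists N.
  apply/cvgrPdist_le => e e0.
  have [//|N _ HN] := closew (Num.truncn e^-1).
  exists N => // n /HN /le_trans; apply.
  by rewrite invf_ple ?posrE // ltW // truncnS_gt.
apply: bigcapT_measurable => j; apply: bigcupT_measurable => N.
by apply: bigcap_measurableType => n _.
Qed.

End Almost.

Theorem theorem2p16 (R : realType) (P : probability seqspace R) :
  is_mu0 P -> measurable (good_set R) /\ P (good_set R) = 1%E.
Proof.
move=> mu0; have mgood := measurable_good_set R; split=> //.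
have msup p : measurable (lim_sup_set (deviates_early p)).
  apply: bigcapT_measurable => n; apply: bigcup_measurable => m _.
  exact: measurable_deviates_early.
have bad0 : P (~` good_set R) = 0%E.
  apply/negligibleP; first exact: measurableC.
  (* If the limit fails, infinitely many early deviations occur for some [p]; countably many null
     sets suffice. *)
  apply: (@negligibleS _ _ _ _ (\bigcup_p lim_sup_set (deviates_early p.+2))).
    move=> w; apply: contra_notP => notsup; apply: not_limsup_good => p supw.
    by apply: notsup; exists p.
  apply: negligible_bigcup => p; apply/negligibleP => //.
  exact: mu0_limsup_deviates_early.
have := probability_setC P (measurableC mgood).
by rewrite setCK bad0 sube0.
Qed.
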